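(* Let $l$ be a positive odd integer. Then there exists a positive integer $N_l$ (depending on $l$) such that for all integers $n\geq N_l$, the product $P_{2,l}(n)=\prod_{k=1}^n (2k^2+l)$ is not a perfect square. *)

(* Defs.v *)
From mathcomp Require Import all_boot.

Set Implicit Arguments.
Unset Strict Implicit.
Unset Printing Implicit Defensive.

Definition P (a l n : nat) : nat := \prod_(1 <= k < n.+1) (a * k ^ 2 + l).

Definition perfect_square (m : nat) : Prop := exists r : nat, m = r ^ 2.

(* Main.v *)
Require Import Defs.
From mathcomp Require Import all_boot all_order all_algebra zify ring lra.
From mathcomp Require Import reals sequences exp Rstruct.

(** Call a prime split when it divides some 2 k^2 + l, and put
    H(n) = \sum_(p not split) logn p n`! * ln p.  If P_n = \prod_(k <= n) (2 k^2 + l)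
    is a square, all its prime factors are at most 2 n; as they are split and
    logn p P_n exceeds 2 logn p n`! only slightly, comparing ln P_n with 2 ln n`!
    gives H(n) = O(n): nearly all primes are split.  With N = floor (sqrt n) this
    passes to H(N^2) = O(N^2) and H(N) = O(N).

    This is impossible for the product F of 2 a^2 + l b^2 over 1 <= a, b <= N.
    Indeed ln F <= 2 N^2 ln N + O(N^2), and when nearly all primes are split, the
    primes p <= N (which divide the values of each row a |-> 2 a^2 + l b^2 about
    2 N / p times) already contribute 2 N^2 ln N - O(N^2), while by Thue's box
    argument each split prime N < p <= N^2 divides at least (N^2 / p - 1) / 4 of
    the factors, which adds a further positive multiple of N^2 ln N. *)

(** * Valuations of factorials and of values of 2 k^2 + l *)

Lemma logn_prod_nat p m n (F : nat -> nat) :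
  (forall k, m <= k < n -> 0 < F k) ->
  logn p (\prod_(m <= k < n) F k) = \sum_(m <= k < n) logn p (F k).
Proof.
move=> F_gt0; rewrite big_nat_cond [in RHS]big_nat_cond.
set Q := BIG_P.
suff [-> //] : logn p (\prod_(m <= k < n | Q k) F k) =
  \sum_(m <= k < n | Q k) logn p (F k) /\ 0 < \prod_(m <= k < n | Q k) F k.
elim/big_rec2: _ => [|k x y /andP[/F_gt0 Fk_gt0 _] [<- y_gt0]]; first by rewrite logn1.
by rewrite lognM ?muln_gt0 ?Fk_gt0.
Qed.

Lemma sum_logn_fact p n : \sum_(1 <= k < n.+1) logn p k = logn p n`!.
Proof.
elim: n => [|n IHn]; first by rewrite big_geq // fact0 logn1.
by rewrite big_nat_recr //= IHn factS lognM ?fact_gt0 // addnC.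
Qed.

Lemma sum_logn_fact_shift p n m :
  \sum_(1 <= k < n.+1) logn p (k + m) + logn p m`! = logn p (n + m)`!.
Proof.
elim: n => [|n IHn]; first by rewrite big_geq.
by rewrite big_nat_recr //= addnAC IHn addSn factS lognM ?fact_gt0 // addnC.
Qed.

Lemma logn_fact_wide p n m : prime p -> n <= m ->
  logn p n`! = \sum_(1 <= k < m.+1) n %/ p ^ k.
Proof.
move=> p_pr le_nm; rewrite logn_fact // [RHS](big_cat_nat (n := n.+1)) //=.
rewrite [X in _ + X]big_nat_cond [X in _ + X]big1 ?addn0 // => k.
rewrite andbT => /andP[lt_nk _]; apply: divn_small.
exact: ltn_trans lt_nk (ltn_expl k (prime_gt1 p_pr)).
Qed.

(** Legendre's formula in recursive form: dropping the first term leaves the formula for [n %/ p],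
    since iterated floors compose. *)
Lemma logn_factE p n : prime p -> logn p n`! = n %/ p + logn p (n %/ p)`!.
Proof.
move=> p_pr; case: n => [|n]; first by rewrite div0n fact0 logn1.
rewrite logn_fact // big_ltn // expn1; congr (_ + _).
rewrite (@logn_fact_wide p _ n) //; last first.
  by rewrite -ltnS ltn_Pdiv // prime_gt1.
by rewrite big_add1 /=; apply: eq_bigr => k _; rewrite expnS divnMA.
Qed.

(** The bound n / (p - 1) from summing Legendre's formula as a geometric series, obtained by
    induction along the recursion. *)
Lemma logn_fact_leq p n : prime p -> p.-1 * logn p n`! <= n.
Proof.
move=> p_pr; have p_gt1 := prime_gt1 p_pr.
elim/ltn_ind: n => -[|n] IHn; first by rewrite fact0 logn1 muln0.
rewrite logn_factE // mulnDr.
have lt_q : n.+1 %/ p < n.+1 by rewrite ltn_Pdiv.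
have := IHn _ lt_q; have := leq_divM n.+1 p.
case: p p_pr p_gt1 {lt_q IHn} => //= p _ _; nia.
Qed.

(** Binomial coefficients are integers. *)
Lemma logn_factD_ge p m n : logn p m`! + logn p n`! <= logn p (m + n)`!.
Proof.
rewrite -lognM ?fact_gt0 // dvdn_leq_log ?fact_gt0 //.
by rewrite -(bin_fact (leq_addr n m)) addKn dvdn_mull.
Qed.

Lemma logn_factM_ge p k n : k * logn p n`! <= logn p (k * n)`!.
Proof.
elim: k => // k IHk; rewrite !mulSn.
by apply: leq_trans (logn_factD_ge _ _ _); rewrite leq_add2l.
Qed.

(* Kummer: each power of p not exceeding m + n contributes at most one carry. *)
Lemma logn_factD_le p m n : prime p ->
  logn p (m + n)`! <= logn p m`! + logn p n`! + trunc_log p (m + n).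
Proof.
move=> p_pr; have p_gt1 := prime_gt1 p_pr.
rewrite !(@logn_fact_wide p _ (m + n)) ?leq_addr ?leq_addl //.
have -> : trunc_log p (m + n) = \sum_(1 <= k < (trunc_log p (m + n)).+1) 1.
  by rewrite sum_nat_const_nat muln1 subn1.
set t := trunc_log _ _.
have [->|mn_gt0] := posnP (m + n); first by rewrite big_geq.
have le_t : t <= m + n.
  have : p ^ t <= m + n by rewrite trunc_logP.
  by apply: leq_trans; apply/ltnW/ltn_expl.
rewrite -big_split /=.
have split_t F : \sum_(1 <= k < (m + n).+1) F k = \sum_(1 <= k < t.+1) F k +
    \sum_(t.+1 <= k < (m + n).+1) F k :> nat by rewrite -big_cat_nat.
rewrite [leqLHS]split_t [X in _ <= X + _]split_t addnAC -big_split /=.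
apply: leq_add.
  apply: leq_sum => k _; rewrite divnD ?expn_gt0 ?(ltnW p_gt1) //.
  by rewrite leq_add2l leq_b1.
rewrite big_nat_cond big1 // => k; rewrite andbT => /andP[lt_tk _].
apply: divn_small; apply: leq_trans (trunc_log_ltn _ p_gt1) _.
by rewrite leq_exp2l.
Qed.

(** The two values differ by 2 (k - j) (k + j), and the factor 2 is coprime to p. *)
Lemma leq_logn_diff_sum p e l j k : prime p -> odd p -> j < k ->
  p ^ e %| 2 * j ^ 2 + l -> p ^ e %| 2 * k ^ 2 + l ->
  e <= logn p (k - j) + logn p (k + j).
Proof.
move=> p_pr p_odd lt_jk dvd_j dvd_k.
rewrite -lognM ?subn_gt0 //; last by lia.
rewrite -pfactor_dvdn ?muln_gt0 ?subn_gt0 ?lt_jk //=; last by lia.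
rewrite -(@Gauss_dvdr _ 2); last by rewrite coprime_sym coprime2n oddX p_odd orbT.
rewrite -(dvdn_addr _ dvd_j).
by rewrite (_ : _ + _ = 2 * k ^ 2 + l) //; rewrite -subn_sqr; nia.
Qed.

(* Compare every term with the one of maximal valuation, at k0: if p ^ e divides both
   2 k ^ 2 + l and 2 k0 ^ 2 + l, it divides (k - k0) (k + k0). *)
Lemma sum_logn_form_leq p l n : prime p -> odd p -> 0 < l ->
  \sum_(1 <= k < n.+1) logn p (2 * k ^ 2 + l) <=
    2 * logn p n`! + trunc_log p (2 * n ^ 2 + l) + trunc_log p (2 * n).
Proof.
move=> p_pr p_odd l_gt0; case: n => [|n]; first by rewrite big_geq.
have p_gt1 := prime_gt1 p_pr.
have form_gt0 k : 0 < 2 * k ^ 2 + l by rewrite addn_gt0 l_gt0 orbT.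
pose v k := logn p (2 * k ^ 2 + l).
have v_dvd e k : e <= v k -> p ^ e %| 2 * k ^ 2 + l.
  by rewrite pfactor_dvdn.
have [k0 [k0_gt0 le_k0n k0_max]] : exists k0,
    [/\ 0 < k0, k0 <= n.+1 & forall k, 0 < k <= n.+1 -> v k <= v k0].
  case: (@arg_maxnP _ (ord0 : 'I_n.+1) xpredT (fun i => v i.+1)) => // i _ imax.
  exists i.+1; split=> // -[//|k] /andP[_ lt_kn].
  exact: (imax (Ordinal lt_kn)).
rewrite -/(v _) (big_cat_nat (n := k0)) ?(leqW le_k0n) //=.
rewrite [X in _ + X]big_ltn ?ltnS //.
have lower : \sum_(1 <= k < k0) logn p (2 * k ^ 2 + l) <=
    logn p (k0.-1)`! + \sum_(1 <= k < k0) logn p (k + k0).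
  have -> : logn p (k0.-1)`! = \sum_(1 <= k < k0) logn p (k0 - k).
    rewrite -sum_logn_fact prednK // [RHS]big_nat_rev.
    rewrite big_nat_cond [RHS]big_nat_cond; apply: eq_bigr => k.
    by rewrite andbT => /andP[_ lt_kk0]; congr logn; lia.
  rewrite -big_split big_nat_cond [X in _ <= X]big_nat_cond.
  apply: leq_sum => k; rewrite andbT => /andP[k_gt0 lt_kk0].
  rewrite [k + k0]addnC; apply: leq_logn_diff_sum => //; apply: v_dvd => //.
  by apply: k0_max; lia.
have upper : \sum_(k0.+1 <= k < n.+2) logn p (2 * k ^ 2 + l) <=
    logn p (n.+1 - k0)`! + \sum_(k0.+1 <= k < n.+2) logn p (k + k0).
  have -> : logn p (n.+1 - k0)`! = \sum_(k0.+1 <= k < n.+2) logn p (k - k0).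
    rewrite -sum_logn_fact -[k0.+1]add1n big_addn (subSn le_k0n).
    by apply: eq_bigr => k _; rewrite addnK.
  rewrite -big_split big_nat_cond [X in _ <= X]big_nat_cond.
  apply: leq_sum => k; rewrite andbT => /andP[lt_k0k lt_kn].
  apply: leq_logn_diff_sum => //; apply: v_dvd => //.
  by apply: k0_max; lia.
have mid : v k0 <= trunc_log p (2 * n.+1 ^ 2 + l).
  apply: trunc_log_max => //; apply: leq_trans (dvdn_leq _ (v_dvd _ _ (leqnn _))) _ => //.
  by rewrite leq_add2r leq_mul2l leq_exp2r.
have sums : \sum_(1 <= k < k0) logn p (k + k0) +
    \sum_(k0.+1 <= k < n.+2) logn p (k + k0) <=
    \sum_(1 <= k < n.+2) logn p (k + k0).
  rewrite [X in _ <= X](big_cat_nat (n := k0)) ?(leqW le_k0n) //=.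
  by rewrite leq_add2l [X in _ <= X]big_ltn ?ltnS // leq_addl.
(* The differences contribute at most the valuation of [n.+1]![. The sums k + k0 contribute at most
   that of the quotient of](n.+1 + k0)[!] by [k0]![, which Kummer bounds by that of]n.+1[!] plus one
   logarithm. *)
have := sum_logn_fact_shift p n.+1 k0.
have := @logn_factD_le p n.+1 k0 p_pr.
have : trunc_log p (n.+1 + k0) <= trunc_log p (2 * n.+1).
  by apply: leq_trunc_log; lia.
have := logn_factD_ge p k0.-1 (n.+1 - k0).
have : logn p (k0.-1 + (n.+1 - k0))`! <= logn p n.+1`!.
  rewrite dvdn_leq_log ?fact_gt0 // (_ : _ + _ = n); last by lia.
  by rewrite factS dvdn_mull.
rewrite -/(v k0); lia.
Qed.

(** * Prime factors of a square product *)

Lemma logn_small p m : m < p -> logn p m = 0.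
Proof.
case: m => [|m] lt_mp; first by rewrite logn0.
by rewrite lognE gtnNdvd // !andbF.
Qed.

(** Searching only the residues modulo p makes the property boolean. For odd p it says that - 2 l is
    a square modulo p. *)
Definition quad_split (l p : nat) : bool :=
  [exists r : 'I_p, p %| 2 * r ^ 2 + l].

Lemma quad_splitI l p k : 0 < p -> p %| 2 * k ^ 2 + l -> quad_split l p.
Proof.
move=> p_gt0 dvd_k; apply/existsP; exists (Ordinal (ltn_pmod k p_gt0)) => /=.
by rewrite /dvdn -modnDml -modnMmr modnXm modnMmr modnDml.
Qed.

(** A prime p > 2 n divides at most one factor, as it would otherwise divide some (k - j) (k + j)
    with both terms positive and below p. In a square its valuation is even, so p ^ 2 divides that
    factor, which is at most 2 n ^ 2 + n < p ^ 2. *)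
Lemma prime_dvd_square_P l n p : odd l -> l <= n -> prime p ->
  perfect_square (P 2 l n) -> p %| P 2 l n -> [/\ odd p, p <= 2 * n & quad_split l p].
Proof.
move=> l_odd le_ln p_pr [s Ps] p_dvd.
have l_gt0 : 0 < l by case: l l_odd {le_ln Ps p_dvd}.
have form_gt0 k : 0 < 2 * k ^ 2 + l by rewrite addn_gt0 l_gt0 orbT.
have logP : logn p (P 2 l n) = \sum_(1 <= k < n.+1) logn p (2 * k ^ 2 + l).
  exact: logn_prod_nat.
have P_gt0 : 0 < P 2 l n by rewrite prodn_gt0.
have [k /andP[k_gt0 le_kn] dvd_k] : exists2 k, 0 < k < n.+1 & p %| 2 * k ^ 2 + l.
  move: p_dvd; rewrite /P Euclid_dvd_prod // big_has => /hasP[k].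
  by rewrite mem_index_iota; exists k.
have p_odd : odd p.
  case: (even_prime p_pr) => // p2; move: dvd_k.
  by rewrite p2 dvdn2 oddD oddM l_odd.
split=> //; last exact: quad_splitI (prime_gt0 p_pr) dvd_k.
rewrite leqNgt; apply/negP => lt_np.
have only_k : logn p (P 2 l n) = logn p (2 * k ^ 2 + l).
  rewrite logP (bigD1_seq k) ?mem_index_iota ?iota_uniq ?k_gt0 //=.
  rewrite big1_seq ?addn0 // => j /andP[j_neq]; rewrite mem_index_iota => /andP[j_gt0 le_jn].
  apply/eqP; rewrite -leqn0 leqNgt; apply/negP => v_gt0.
  have dvd_j : p ^ 1 %| 2 * j ^ 2 + l by rewrite pfactor_dvdn.
  have lt_or : j < k \/ k < j by lia.
  case: lt_or => lt_.
    have := @leq_logn_diff_sum p 1 l _ _ p_pr p_odd lt_ dvd_j dvd_k.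
    by rewrite !logn_small //; lia.
  have := @leq_logn_diff_sum p 1 l _ _ p_pr p_odd lt_ dvd_k dvd_j.
  by rewrite !logn_small //; lia.
have : p ^ 2 %| 2 * k ^ 2 + l.
  rewrite pfactor_dvdn // -only_k.
  have : 0 < logn p (P 2 l n) by rewrite only_k -pfactor_dvdn // expn1.
  by rewrite Ps lognX; lia.
move/(dvdn_leq (form_gt0 k)); nia.
Qed.

(** * Zeros of 2 a^2 + l b^2 modulo a split prime *)

Lemma sum_dvd_shift_geq p N c : 0 < p ->
  N %/ p <= \sum_(1 <= a < N.+1) (p %| a + c).
Proof.
move=> p_gt0.
have : \sum_(1 <= a < N.+1) (p %| a + c) + c %/ p = (N + c) %/ p.
  elim: N => [|N IHN]; first by rewrite big_geq.
  by rewrite big_nat_recr //= addnAC IHN addSn divnS // addnC.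
by rewrite divnD //; lia.
Qed.

(** For fixed b the form vanishes modulo p on the two classes a = - r b and a = r b, the latter
    written with p - r in place of - r. Each class meets the range at least [N %/ p] times. *)
Lemma sum_logn_form2_geq p l b N : prime p -> odd p -> ~~ (p %| l) ->
  quad_split l p -> 0 < b ->
  2 * (N %/ p) <= \sum_(1 <= a < N.+1) logn p (2 * a ^ 2 + l * b ^ 2).
Proof.
move=> p_pr p_odd p_ndvd /existsP[[r lt_rp] /= dvd_r] b_gt0.
have p_gt0 := prime_gt0 p_pr.
have l_gt0 : 0 < l by rewrite lt0n; apply: contraNneq p_ndvd => ->.
have p_ndvd2 : ~~ (p %| 2).
  by rewrite dvdn_prime2 //; apply: contraTneq p_odd => ->.
rewrite mul2n -addnn.
apply: leq_trans (leq_add (sum_dvd_shift_geq p N (r * b) p_gt0)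
  (sum_dvd_shift_geq p N ((p - r) * b) p_gt0)) _.
rewrite -big_split; apply: leq_sum => a _ /=.
have form_gt0 : 0 < 2 * a ^ 2 + l * b ^ 2.
  by rewrite addn_gt0 orbC muln_gt0 l_gt0 expn_gt0 b_gt0.
(* (a + r b)(a - r b) = a^2 - r^2 b^2 and 2 r^2 = - l modulo p *)
have key : 2 * (a + r * b) * (a + (p - r) * b) + (2 * r ^ 2 + l) * b ^ 2 =
    2 * a ^ 2 + l * b ^ 2 + p * (2 * (a * b + r * b ^ 2)).
  by rewrite -{2}(subnK (ltnW lt_rp)); ring.
have dvd_form : (p %| a + r * b) || (p %| a + (p - r) * b) ->
    p %| 2 * a ^ 2 + l * b ^ 2.
  move=> dvd_or; rewrite -(@dvdn_addl (p * (2 * (a * b + r * b ^ 2)))) ?dvdn_mulr //.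
  rewrite -key dvdn_add ?(dvdn_mulr _ dvd_r) //.
  by case/orP: dvd_or => ?; [rewrite dvdn_mulr ?dvdn_mull | rewrite dvdn_mull].
case: (boolP (p %| a + r * b)) dvd_form => [d1|_]; case: (boolP (p %| _)) => [d2|_] //= dvd_form.
(* If a lies in both classes it is counted twice, so valuation 2 is needed: p divides 2 a, hence a,
   hence r b, and p does not divide r because it does not divide l. So p divides both a and b. *)
- rewrite -pfactor_dvdn //.
  have dvd_a : p %| a.
    have : p %| 2 * a.
      have : p %| (a + r * b) + (a + (p - r) * b) by rewrite dvdn_add.
      rewrite (_ : _ + _ = 2 * a + p * b); last first.
        by rewrite -{2}(subnK (ltnW lt_rp)); ring.
      by rewrite dvdn_addl // dvdn_mulr.
    by rewrite Euclid_dvdM // (negPf p_ndvd2).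
  have dvd_b : p %| b.
    move: d1; rewrite dvdn_addr // Euclid_dvdM // => /orP[dr|//].
    by move: dvd_r; rewrite dvdn_addr ?(negPf p_ndvd) // dvdn_mull // dvdn_exp.
  by rewrite dvdn_add // dvdn_mull // dvdn_exp2r.
- by rewrite logn_gt0 mem_primes p_pr form_gt0 dvd_form.
- by rewrite logn_gt0 mem_primes p_pr form_gt0 dvd_form.
Qed.

Import Order.TTheory GRing.Theory Num.Theory.

(** Each distance to i0 is attained at most twice, once on either side. *)
Lemma sum_distn_leq N i0 (h : nat -> nat) : i0 < N ->
  \sum_(0 <= i < N) h (i - i0 + (i0 - i)) <= 2 * \sum_(0 <= d < N) h d.
Proof.
move=> lt_i0N; rewrite (big_cat_nat (n := i0)) ?(ltnW lt_i0N) //= mul2n -addnn.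
apply: leq_add.
  rewrite big_nat_rev add0n (big_cat_nat (n := i0.+1) (p := N)) //=.
  apply: leq_trans (leq_addr _ _); rewrite [leqRHS]big_ltn // big_add1 /=.
  apply: leq_trans (leq_addl _ _).
  rewrite big_nat_cond [leqRHS]big_nat_cond; apply: leq_sum => i.
  by rewrite andbT => /andP[_ lt_i]; rewrite (_ : _ + _ = i.+1) //; lia.
rewrite -{1}[i0]add0n big_addn (big_cat_nat (n := N - i0) (p := N)) ?leq_subr //=.
apply: leq_trans (leq_addr _ _); apply: leq_sum => i _.
by rewrite (_ : _ + _ = i) //; lia.
Qed.

(* The distance |i - i0| is written i - i0 + (i0 - i) with truncated subtractions. *)
Lemma dvd_form2_diff p l r i i0 j j0 : p %| 2 * r ^ 2 + l ->
  i + r * j = i0 + r * j0 %[mod p] ->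
  p %| 2 * (i - i0 + (i0 - i)) ^ 2 + l * (j - j0 + (j0 - j)) ^ 2.
Proof.
move=> /dvdnP[w def_w] /eqP; rewrite -eqz_nat -!modz_nat eqz_mod_dvd => /dvdzP[t def_t].
suff : (p%:Z %| (2 * (i - i0 + (i0 - i)) ^ 2 + l * (j - j0 + (j0 - j)) ^ 2)%N%:Z)%Z by [].
pose D := (i%:Z - i0%:Z)%R; pose E := (j%:Z - j0%:Z)%R.
(* The witness comes from 2 D^2 + l E^2 = 2 (D + r E) (D - r E) + (2 r^2 + l) E^2, with D + r E = t
   p and 2 r^2 + l = w p. *)
apply/dvdzP; exists (2 * t * (D - r%:Z * E) + w%:Z * E ^+ 2)%R.
have dist a b : ((a - b + (b - a))%N%:Z ^+ 2 = (a%:Z - b%:Z) ^+ 2 :> int)%R.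
  by case: (leqP a b) => ?; nia.
have PoszX m : ((m ^ 2)%N%:Z = m%:Z ^+ 2)%R by rewrite -mulnn PoszM.
rewrite PoszD PoszM [Posz (l * _)]PoszM !PoszX !dist -/D -/E.
have hw : (2 * r%:Z ^+ 2 + l%:Z = w%:Z * p%:Z)%R by rewrite -PoszM -def_w PoszD PoszM PoszX.
have ht : (D + r%:Z * E = t * p%:Z)%R by rewrite -def_t /D /E; lia.
rewrite mulrDl (_ : 2 * t * _ * _ = 2 * (t * p%:Z) * (D - r%:Z * E))%R; last by ring.
rewrite -ht (_ : w%:Z * _ * _ = (w%:Z * p%:Z) * E ^+ 2)%R; last by ring.
by rewrite -hw; ring.
Qed.

(* Thue's box argument: some class of [(a, b) |-> a + r b] modulo [p] has at least
   [N ^ 2 %/ p] points in the box, and the differences of two of them are zeros of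
   the form; the factor 4 accounts for the signs of the coordinates. *)
Lemma count_dvd_form2_geq p l N : prime p -> odd p -> ~~ (p %| l) -> quad_split l p -> N <= p ->
  N ^ 2 %/ p <= 1 + 4 * \sum_(1 <= a < N) \sum_(1 <= b < N) (p %| 2 * a ^ 2 + l * b ^ 2).
Proof.
move=> p_pr p_odd p_ndvd /existsP[[r lt_rp] /= dvd_r] le_Np.
have p_gt0 := prime_gt0 p_pr.
have dist_lt a b : a < N -> b < N -> a - b + (b - a) < p by move: le_Np; clear; lia.
have dist0 a b : a - b + (b - a) = 0 -> a = b by clear; lia.
have [->//|q_gt0] := posnP (N ^ 2 %/ p); set q := N ^ 2 %/ p in q_gt0 *.
pose f (x : 'I_N * 'I_N) := Ordinal (ltn_pmod (x.1 + r * x.2) p_gt0).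
have [c c_big] : exists c, q <= #|[pred x | f x == c]|.
  apply/existsP; rewrite -[X in is_true X]negbK negb_exists; apply/negP => /forallP small.
  have : \sum_(c < p) #|[pred x | f x == c]| = N * N.
    rewrite -[in RHS](card_ord N) -card_prod -sum1_card.
    rewrite (partition_big f xpredT) //; apply: eq_bigr => c _.
    by rewrite -sum1_card.
  have : \sum_(c < p) #|[pred x | f x == c]| <= \sum_(c < p) q.-1.
    by apply: leq_sum => c _; have := small c; lia.
  rewrite sum_nat_const card_ord; have := leq_divM (N ^ 2) p; rewrite -/q; nia.
have [x0 x0c] : exists x0, f x0 == c.
  by apply/existsP; move: (leq_trans q_gt0 c_big) => /card_gt0P[x xc]; apply/existsP; exists x.
(* [g] vanishes when a coordinate is 0, so its sums may start at 0, where distances naturally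
   range. *)
pose g d e : nat := [&& 0 < d, 0 < e & p %| 2 * d ^ 2 + l * e ^ 2].
have cls x : f x == c -> x != x0 -> 
    g (x.1 - x0.1 + (x0.1 - x.1)) (x.2 - x0.2 + (x0.2 - x.2)) = 1.
  move=> xc xx0; have /eqP := etrans (eqP xc) (esym (eqP x0c)).
  rewrite -val_eqE /= => /eqP eq_mod.
  have := ltn_ord x.1; have := ltn_ord x0.1; have := ltn_ord x.2; have := ltn_ord x0.2.
  move=> lt1 lt2 lt3 lt4.
  have dvd_form := dvd_form2_diff _ _ _ _ _ _ _ dvd_r eq_mod.
  have lt_d := dist_lt _ _ lt4 lt3; have lt_e := dist_lt _ _ lt2 lt1.
  have small m : m < p -> (p %| m) = (m == 0).
    by case: m => [|m] lt_mp; rewrite ?dvdn0 // gtnNdvd.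
  have p_ndvd2 : ~~ (p %| 2).
    by rewrite dvdn_prime2 //; apply: contraTneq p_odd => ->.
  (* If one difference is 0, p divides the square of the other, which is below p and thus also 0;
     then x = x0. *)
  have coord_gt0 : (x.1 - x0.1 + (x0.1 - x.1) != 0) && (x.2 - x0.2 + (x0.2 - x.2) != 0).
    have xx0' : ~ (nat_of_ord x.1 = x0.1 /\ nat_of_ord x.2 = x0.2).
      by case=> e1 e2; case/eqP: xx0; case: (x) (x0) e1 e2 => [x1 x2] [y1 y2] /= /val_inj -> /val_inj ->.
    rewrite -negb_or; apply/negP => /orP[/eqP e0|/eqP e0].
      move: dvd_form; rewrite e0 /= muln0 add0n Euclid_dvdM // (negPf p_ndvd) Euclid_dvdX //.
      by rewrite small // andbT => /eqP /dist0 e1; apply: xx0'; split=> //; apply: dist0.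
    move: dvd_form; rewrite e0 /= muln0 addn0 Euclid_dvdM // (negPf p_ndvd2) Euclid_dvdX //.
    by rewrite small // andbT => /eqP /dist0 e1; apply: xx0'; split=> //; apply: dist0.
  by case/andP: coord_gt0; rewrite -!lt0n /g dvd_form => -> ->.
apply: leq_trans c_big _.
rewrite -sum1_card (bigD1 x0) //= leq_add2l.
have le1 : \sum_(x | (f x == c) && (x != x0)) 1 <=
    \sum_(0 <= i < N) \sum_(0 <= j < N) g (i - x0.1 + (x0.1 - i)) (j - x0.2 + (x0.2 - j)).
  rewrite big_mkord; under [leqRHS]eq_bigr => i _ do rewrite big_mkord.
  rewrite pair_bigA /= [leqRHS](bigID (fun x => (f x == c) && (x != x0))) /=.
  apply: leq_trans (leq_addr _ _); apply: leq_sum => x /andP[xc xx0].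
  by rewrite cls.
apply: leq_trans le1 _.
apply: leq_trans (sum_distn_leq _ _ (fun d => \sum_(0 <= j < N) g d (j - x0.2 + (x0.2 - j))) (ltn_ord x0.1)) _.
rewrite -[4]/(2 * 2) -mulnA leq_mul2l /=.
have N_gt0 : 0 < N by apply: leq_ltn_trans (leq0n _) (ltn_ord x0.1).
have -> : \sum_(1 <= a < N) \sum_(1 <= b < N) (p %| 2 * a ^ 2 + l * b ^ 2) =
    \sum_(0 <= a < N) \sum_(0 <= b < N) g a b.
  rewrite [RHS]big_ltn // [X in _ = X + _]big1 ?add0n; last by move=> j _; rewrite /g.
  rewrite big_nat_cond [RHS]big_nat_cond; apply: eq_bigr => a.
  rewrite andbT => /andP[a_gt0 _]; rewrite [RHS]big_ltn // {1}/g andbF add0n.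
  rewrite big_nat_cond [RHS]big_nat_cond; apply: eq_bigr => b.
  by rewrite andbT => /andP[b_gt0 _]; rewrite /g a_gt0 b_gt0.
rewrite big_distrr /=; apply: leq_sum => d _; exact: sum_distn_leq _ _ _ (ltn_ord x0.2).
Qed.

(** * The product of the form over the box *)

Definition box_prod (l N : nat) : nat :=
  \prod_(1 <= b < N.+1) \prod_(1 <= a < N.+1) (2 * a ^ 2 + l * b ^ 2).

Lemma form2_gt0 l a b : 0 < l -> 0 < b -> 0 < 2 * a ^ 2 + l * b ^ 2.
Proof. by move=> l_gt0 b_gt0; rewrite addn_gt0 orbC muln_gt0 l_gt0 expn_gt0 b_gt0. Qed.

Lemma box_prod_row_gt0 l N b : 0 < l -> 0 < b ->
  0 < \prod_(1 <= a < N.+1) (2 * a ^ 2 + l * b ^ 2).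
Proof. by move=> l_gt0 b_gt0; rewrite prodn_gt0 // => a; apply: form2_gt0. Qed.

Lemma box_prod_gt0 l N : 0 < l -> 0 < box_prod l N.
Proof.
move=> l_gt0; rewrite /box_prod big_add1 prodn_gt0 // => b.
exact: box_prod_row_gt0.
Qed.

Lemma logn_box_prod p l N : 0 < l -> logn p (box_prod l N) =
  \sum_(1 <= b < N.+1) \sum_(1 <= a < N.+1) logn p (2 * a ^ 2 + l * b ^ 2).
Proof.
move=> l_gt0; rewrite /box_prod logn_prod_nat; last first.
  by move=> b /andP[b_gt0 _]; apply: box_prod_row_gt0.
rewrite big_nat_cond [RHS]big_nat_cond; apply: eq_bigr => b.
rewrite andbT => /andP[b_gt0 _].
by rewrite logn_prod_nat // => a _; apply: form2_gt0.
Qed.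

(* Every term of the right-hand side but the first is O(N ^ 2) after weighting by
   ln p and summing over p, except the next to last one, which gives N ^ 2 ln N. *)
Lemma box_prod_valuation p l N : prime p -> odd l -> l <= N ->
  8 * N * (N %/ p) + logn p (N ^ 2)`! <= 4 * logn p (box_prod l N) +
    ~~ quad_split l p * (8 * N * (N %/ p) + logn p (N ^ 2)`!) +
    (p %| l) * (8 * N * (N %/ p)) + (p <= N) * logn p (N ^ 2)`! + (p <= N ^ 2).
Proof.
move=> p_pr l_odd le_lN; have p_gt0 := prime_gt0 p_pr.
have l_gt0 : 0 < l by case: l l_odd {le_lN}.
case: (boolP (quad_split l p)) => [p_split|_]; last first.
  by rewrite mul1n; move: (8 * N * _) (logn p _`!) => X V; lia.
have p_odd : odd p.
  case: (even_prime p_pr) => // p2; move: p_split => /existsP[r].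
  by rewrite [X in (X %| _)]p2 dvdn2 oddD oddM l_odd.
case: (leqP p N) => [le_pN|lt_Np].
  case: (boolP (p %| l)) => [_|p_ndvd].
    by rewrite !mul1n; move: (8 * N * _) (logn p _`!) => X V; lia.
  have : 2 * N * (N %/ p) <= logn p (box_prod l N).
    rewrite logn_box_prod // (mulnC 2) -mulnA.
    apply: (@leq_trans (\sum_(1 <= b < N.+1) 2 * (N %/ p))).
      by rewrite sum_nat_const_nat subn1.
    rewrite big_nat_cond [leqRHS]big_nat_cond; apply: leq_sum => b.
    by rewrite andbT => /andP[b_gt0 _]; apply: sum_logn_form2_geq.
  have -> : 8 * N * (N %/ p) = 4 * (2 * N * (N %/ p)) by rewrite !mulnA.
  by rewrite mul1n; move: (2 * N * _) (logn p _`!) (logn p _) => X V f; lia.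
have p_ndvd : ~~ (p %| l) by rewrite gtnNdvd // (leq_ltn_trans le_lN).
(* For N < p the quotient [N %/ p] is 0, and [N ^ 2 %/ p] is below p, so Legendre's formula reduces
   to its first term, which Thue's argument bounds. The term [p <= N ^ 2] absorbs the 1 lost
   there. *)
rewrite divn_small // muln0 add0n mul0n addn0.
have le_q : N ^ 2 %/ p <= N by rewrite -(leq_pmul2r p_gt0) (leq_trans (leq_divM _ _)) // -mulnn leq_mul2l ltnW ?orbT.
rewrite logn_factE // (logn_factE _ (N ^ 2 %/ p)) //.
rewrite (divn_small (leq_ltn_trans le_q lt_Np)) fact0 logn1 !addn0.
case: (leqP p (N ^ 2)) => [_|lt_p]; last by rewrite divn_small.
rewrite [leqRHS]addnC.
apply: leq_trans (count_dvd_form2_geq p l N p_pr p_odd p_ndvd p_split (ltnW lt_Np)) _.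
rewrite !muln0 !addn0 leq_add2l leq_mul2l /= logn_box_prod // exchange_big_nat /=.
have last_row (F : nat -> nat) : \sum_(1 <= a < N) F a <= \sum_(1 <= a < N.+1) F a.
  case: (N) => [|n]; first by rewrite big_geq.
  by rewrite [leqRHS]big_nat_recr //= leq_addr.
apply: leq_trans (last_row _).
rewrite big_nat_cond [leqRHS]big_nat_cond; apply: leq_sum => b.
rewrite andbT => /andP[b_gt0 _]; apply: leq_trans (last_row _); apply: leq_sum => a _.
case: (boolP (p %| _)) => // dvd_p.
by rewrite logn_gt0 mem_primes p_pr dvd_p form2_gt0.
Qed.

(** * Logarithms and sums over primes *)

Local Open Scope ring_scope.

(** As [ln] is 0 at 0 by default, [lnn] is nonnegative and monotone on all of [nat]. *)
Definition lnn {R : realType} (n : nat) : R := ln n%:R.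

Lemma lnn_ge0 (R : realType) n : 0 <= lnn n :> R.
Proof. by case: n => [|n]; [rewrite /lnn ln0 | rewrite ln_ge0 // ler1n]. Qed.

Lemma ler_lnn (R : realType) m n : (m <= n)%N -> lnn m <= lnn n :> R.
Proof.
case: m => [|m] le_mn; first by rewrite {1}/lnn ln0 // lnn_ge0.
by rewrite /lnn ler_ln ?posrE ?ltr0n ?ler_nat // (leq_trans _ le_mn).
Qed.

Lemma lnnM (R : realType) m n : (0 < m)%N -> (0 < n)%N ->
  lnn (m * n) = lnn m + lnn n :> R.
Proof. by move=> m_gt0 n_gt0; rewrite /lnn natrM lnM ?posrE ?ltr0n. Qed.

Lemma lnnX (R : realType) m n : (0 < m)%N -> lnn (m ^ n) = n%:R * lnn m :> R.
Proof. by move=> m_gt0; rewrite /lnn natrX lnXn ?ltr0n // mulr_natl. Qed.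

Lemma lnn_leS (R : realType) n : lnn n.+1 <= n%:R :> R.
Proof. by rewrite /lnn -add1n natrD le_ln1Dx // (lt_le_trans (ltrN10 _) (ler0n _ _)). Qed.

Lemma lnn_prod (R : realType) m n (F : nat -> nat) :
  (forall k, (m <= k < n)%N -> (0 < F k)%N) ->
  lnn (\prod_(m <= k < n) F k)%N = \sum_(m <= k < n) lnn (F k) :> R.
Proof.
move=> F_gt0; rewrite big_nat_cond [in RHS]big_nat_cond; set Q := BIG_P.
suff [-> //] : lnn (\prod_(m <= k < n | Q k) F k)%N =
  \sum_(m <= k < n | Q k) lnn (F k) :> R /\ (0 < \prod_(m <= k < n | Q k) F k)%N.
elim/big_rec2: _ => [|k x y /andP[/F_gt0 Fk_gt0 _] [<- y_gt0]]; first by rewrite /lnn ln1.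
by rewrite lnnM ?muln_gt0 ?Fk_gt0.
Qed.

Lemma ler_sum_widen (R : realType) B B' (Q : pred nat) (f : nat -> R) :
  (forall p, Q p -> 0 <= f p) -> (B <= B')%N ->
  \sum_(0 <= p < B | Q p) f p <= \sum_(0 <= p < B' | Q p) f p.
Proof.
move=> f_ge0 le_BB'; rewrite [leRHS](big_cat_nat (n := B)) //= lerDl.
exact: sumr_ge0.
Qed.

Lemma sum_widen (R : realType) B B' (Q : pred nat) (f : nat -> R) :
  (forall p, (B <= p)%N -> Q p -> f p = 0) -> (B <= B')%N ->
  \sum_(0 <= p < B' | Q p) f p = \sum_(0 <= p < B | Q p) f p.
Proof.
move=> f0 le_BB'; rewrite (big_cat_nat (n := B)) //= [X in _ + X]big_nat_cond.
by rewrite [X in _ + X]big1 ?addr0 // => p /andP[/andP[? _]]; apply: f0.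
Qed.

(** The logarithm of the prime factorization. The free bound B lets several integers be decomposed
    over one common range. *)
Lemma lnn_decomp (R : realType) m B : (0 < m)%N ->
  (forall p, prime p -> (p %| m)%N -> (p < B)%N) ->
  lnn m = \sum_(0 <= p < B | prime p) (logn p m)%:R * lnn p :> R.
Proof.
move=> m_gt0 dvd_lt.
have logn0 p : ~~ (p %| m)%N -> (logn p m)%:R * lnn p = 0 :> R.
  by move=> p_ndvd; rewrite lognE (negPf p_ndvd) !andbF mul0r.
rewrite -(@sum_widen R B (maxn B m.+1)) ?leq_maxl //; last first.
  by move=> p le_Bp p_pr; apply: logn0; apply: contraL le_Bp => ?; rewrite -ltnNge dvd_lt.
rewrite (@sum_widen R m.+1) ?leq_maxr //; last first.
  by move=> p lt_mp _; apply: logn0; rewrite gtnNdvd.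
rewrite -{1}(partnT m_gt0) /partn (bigID prime) /=.
rewrite [X in (_ * X)%N]big1 ?muln1; last first.
  by move=> p /negPf p_npr; rewrite lognE p_npr.
rewrite big_mkcond /= lnn_prod.
  rewrite [RHS]big_mkcond; apply: eq_bigr => p _; case: ifP => p_pr; last by rewrite /lnn ln1.
  by rewrite lnnX ?prime_gt0.
by move=> p _; case: ifP => // p_pr; rewrite expn_gt0 prime_gt0.
Qed.

Lemma lnn_ge_sum (R : realType) m B : (0 < m)%N ->
  \sum_(0 <= p < B | prime p) (logn p m)%:R * lnn p <= lnn m :> R.
Proof.
move=> m_gt0; rewrite (@lnn_decomp R m (B + m.+1)) //.
  by apply: ler_sum_widen (leq_addr _ _) => p _; rewrite mulr_ge0 ?lnn_ge0.
by move=> p p_pr /(dvdn_leq m_gt0); rewrite addnS ltnS => /leq_trans -> //; rewrite leq_addl.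
Qed.

(** The weak Stirling bound, by induction from n ln (1 + 1 / n) <= 1. *)
Lemma lnn_fact_ge (R : realType) n : n%:R * lnn n - n%:R <= lnn n`! :> R.
Proof.
elim: n => [|n IHn]; first by rewrite !mul0r subr0 lnn_ge0.
rewrite factS lnnM ?fact_gt0 //.
suff : n%:R * lnn n.+1 <= n%:R * lnn n + 1 :> R by rewrite -natr1; lra.
case: n {IHn} => [|n]; first by rewrite !mul0r add0r.
have n_gt0 : 0 < n.+1%:R :> R by rewrite ltr0n.
have -> : lnn n.+2 = lnn n.+1 + ln (1 + n.+1%:R^-1) :> R.
  rewrite /lnn -lnM ?posrE //; last by rewrite addr_gt0 ?invr_gt0.
  by rewrite mulrDr mulr1 divff ?gt_eqF // natr1.
rewrite mulrDr lerD2l -ler_pdivlMl // mulr1 le_ln1Dx //.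
by rewrite (lt_trans (ltrN10 _)) // invr_gt0.
Qed.

(** * Estimates of Chebyshev type *)

Lemma prime_dvd_fact p m : prime p -> (p %| m`!)%N = (p <= m)%N.
Proof.
move=> p_pr; case: leqP => [le_pm|lt_mp]; first by rewrite dvdn_fact // prime_gt0.
apply/negbTE; rewrite -(expn1 p) pfactor_dvdn ?fact_gt0 // logn_factE //.
by rewrite divn_small // fact0 logn1.
Qed.

(** The two equal middle coefficients both occur in the expansion of (1 + 1) ^ (2 m + 1). *)
Lemma bin_odd_le m : ('C((2 * m).+1, m) <= 4 ^ m)%N.
Proof.
suff : (2 * 'C((2 * m).+1, m) <= 2 ^ (2 * m).+1)%N by rewrite expnS expnM leq_mul2l.
rewrite -[X in (_ <= X ^ _)%N]/(1 + 1)%N expnDn.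
have sym : 'C((2 * m).+1, m.+1) = 'C((2 * m).+1, m).
  have <- : ((2 * m).+1 - m = m.+1)%N by lia.
  by rewrite bin_sub // ltnW // ltnS leq_pmull.
have lt_m : (m < (2 * m).+2)%N by lia.
have lt_m1 : (m.+1 < (2 * m).+2)%N by lia.
rewrite (bigD1 (Ordinal lt_m)) //= (bigD1 (Ordinal lt_m1)) /=; last first.
  by rewrite -val_eqE /=; lia.
rewrite !exp1n !muln1 addnA mul2n -addnn (leq_trans _ (leq_addr _ _)) // leq_add2l.
by rewrite sym.
Qed.

(** Chebyshev's bound by Erdős's induction: an even n > 2 adds no prime, and for n = 2 m + 1 the
    primes in (m + 1, n] divide the binomial coefficient of n over m, which is at most 4 ^ m;
    finally ln 4 <= 2. *)
Lemma theta_le (R : realType) B n :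
  \sum_(0 <= p < B | prime p) (p <= n)%:R * lnn p <= 2 * n%:R :> R.
Proof.
have theta2 : \sum_(0 <= p < B | prime p) (p <= 2)%:R * lnn p <= 2 :> R.
  apply: (@le_trans _ _ (lnn 2)); last by rewrite (le_trans (lnn_leS R 1)) // ler1n.
  apply: le_trans (lnn_ge_sum R 2 B isT); apply: ler_sum => p p_pr.
  rewrite ler_wpM2r ?lnn_ge0 // ler_nat.
  by case: (leqP p 2) => // le_p2; have/eqP-> : p == 2%N by rewrite eqn_leq le_p2 prime_gt1.
elim/ltn_ind: n => n IHn; case: (leqP n 2) => [le_n2|lt_2n].
  case: n le_n2 {IHn} => [|[|[|//]]] _.
  - by rewrite mulr0 big1 // => p /prime_gt0; case: p => //= p _; rewrite mul0r.
  - rewrite big1 ?mulr1 // => p /prime_gt1; rewrite ltnNge => /negPf ->.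
    by rewrite mul0r.
  - by apply: le_trans theta2 _; rewrite -natrM ler_nat.
case: (boolP (odd n)) => [n_odd|n_even]; last first.
  have -> : \sum_(0 <= p < B | prime p) (p <= n)%:R * lnn p =
      \sum_(0 <= p < B | prime p) (p <= n.-1)%:R * lnn p :> R.
    apply: eq_bigr => p p_pr; congr (_%:R * _); congr nat_of_bool.
    have : p <> n by move=> e; case: (even_prime p_pr) => ?; move: n_even; lia.
    by lia.
  apply: le_trans (IHn n.-1 _) _; first by lia.
  by rewrite ler_wpM2l // ler_nat leq_pred.
have [m def_n] : exists m, n = (2 * m).+1 by exists n./2; lia.
have C_gt0 : (0 < 'C(n, m))%N by rewrite bin_gt0; lia.
have le_split : \sum_(0 <= p < B | prime p) (p <= n)%:R * lnn p <=
    \sum_(0 <= p < B | prime p) (p <= m.+1)%:R * lnn p + lnn 'C(n, m) :> R.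
  apply: le_trans (lerD (lexx _) (lnn_ge_sum R _ B C_gt0)).
  rewrite -big_split; apply: ler_sum => p p_pr /=.
  rewrite -mulrDl -natrD ler_wpM2r ?lnn_ge0 // ler_nat.
  case: (leqP p m.+1) => [_|lt_mp]; first by case: (p <= n)%N => //; lia.
  case: (leqP p n) => // le_pn.
  rewrite -pfactor_dvdn // expn1.
  have : (p %| n`!)%N by rewrite dvdn_fact // prime_gt0.
  rewrite -(bin_fact (m := m)) ?Euclid_dvdM //; last by lia.
  by rewrite !prime_dvd_fact //; case/orP=> //; lia.
have C_le : ('C(n, m) <= 4 ^ m)%N by rewrite def_n bin_odd_le.
apply: le_trans le_split _; apply: le_trans (lerD (IHn m.+1 _) (ler_lnn R _ _ C_le)) _.
  by lia.
have : lnn (4 ^ m) <= 2 * m%:R :> R.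
  rewrite -[4%N]/(2 ^ 2)%N -expnM lnnX // natrM.
  have := lnn_leS R 1; have := ler0n R m; nra.
by rewrite def_n -!natr1 natrM; lra.
Qed.

Lemma sum_lnn_div_le (R : realType) B :
  \sum_(0 <= p < B | prime p) lnn p / (p%:R * p.-1%:R) <= 4 :> R.
Proof.
pose f p : R := lnn p / (p%:R * p.-1%:R).
have f_ge0 p : 0 <= f p by rewrite mulr_ge0 ?lnn_ge0 // invr_ge0 mulr_ge0.
(* Telescoping: ln y^2 <= 2 (y - 1) bounds the term at y^2 = x^2 + 1 by 4 / x - 4 / y. The terms at
   0 and 1 are 0. *)
have tele n : \sum_(0 <= p < n.+2) f p <= 4 - 4 / Num.sqrt n.+1%:R.
  elim: n => [|n IHn].
    by rewrite !big_nat_recr //= big_geq // /f !(mul0r, mulr0, invr0) sqrtr1; lra.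
  rewrite big_nat_recr //=; apply: le_trans (lerD IHn (lexx _)) _.
  rewrite /f /=; set x := Num.sqrt n.+1%:R; set y := Num.sqrt n.+2%:R.
  have x2 : x ^+ 2 = n.+1%:R by rewrite sqr_sqrtr.
  have y2 : y ^+ 2 = n.+2%:R by rewrite sqr_sqrtr.
  have x_ge1 : 1 <= x by rewrite -sqrtr1 ler_sqrt ?ler1n.
  have y_gt0 : 0 < y by rewrite sqrtr_gt0 ltr0n.
  have yx : y ^+ 2 = x ^+ 2 + 1 by rewrite x2 y2 natr1.
  have le_xy : x <= y by rewrite ler_sqrt ?ler_nat.
  have ln_le : lnn n.+2 <= 2 * (y - 1).
    rewrite /lnn -y2 lnXn // mulr_natl ler_wMn2r //.
    by rewrite -{1}(subrK 1 y) addrC le_ln1Dx //; lra.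
  rewrite -x2 -y2.
  have x_gt0 : 0 < x by lra.
  have -> : 4 - 4 / y = 4 - 4 / x + 4 * (y - x) / (x * y).
    by field; rewrite ?gt_eqF.
  rewrite lerD2l ler_pdivrMr ?mulr_gt0 ?exprn_gt0 //.
  have -> : 4 * (y - x) / (x * y) * (y ^+ 2 * x ^+ 2) = 4 * (y - x) * (x * y).
    by field; rewrite ?gt_eqF.
  apply: le_trans ln_le _.
  have key : (y - x) * (y + x) = 1 by rewrite -subr_sqr yx; ring.
  suff : (y - 1) * (y + x) <= 2 * (x * y) * ((y - x) * (y + x)) by nra.
  by rewrite key; nra.
apply: (@le_trans _ _ (\sum_(0 <= p < B) f p)).
  by rewrite big_mkcond; apply: ler_sum => p _; case: ifP.
apply: le_trans (@ler_sum_widen R B B.+2 xpredT f (fun p _ => f_ge0 p) _) _.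
  by rewrite (leq_trans (leqnSn _)).
by apply: le_trans (tele B) _; rewrite gerBl divr_ge0 ?sqrtr_ge0.
Qed.

Lemma exists_sqrt m : exists s, (s ^ 2 <= m < s.+1 ^ 2)%N.
Proof.
elim: m => [|m [s /andP[le_sm lt_ms]]]; first by exists 0%N.
case: (leqP (s.+1 ^ 2) m.+1) => [le_s|lt_s]; last by exists s; lia.
by exists s.+1; rewrite le_s; nia.
Qed.

Lemma trunc_log_lnn_le (R : realType) p m : (1 < p)%N -> (0 < m)%N ->
  (trunc_log p m)%:R * lnn p <= lnn m :> R.
Proof.
by move=> p_gt1 m_gt0; rewrite -lnnX ?ler_lnn ?trunc_logP // ltnW.
Qed.

(** With s the integer square root of m, at most s primes count, and ln m <= 2 ln (s + 1) <= 2 s. *)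
Lemma sum_small_prime_le (R : realType) B m :
  \sum_(0 <= p < B | prime p) (p * p <= m)%:R * lnn m <= 2 * m%:R :> R.
Proof.
have [s /andP[le_sm lt_ms]] := exists_sqrt m.
have count C : (\sum_(0 <= p < C) (0 < p <= s) <= minn C.-1 s)%N.
  elim: C => [|C IHC]; first by rewrite big_geq.
  by rewrite big_nat_recr //=; lia.
have lnm : lnn m <= 2 * s%:R :> R.
  apply: le_trans (ler_lnn R _ _ (ltnW lt_ms)) _.
  by rewrite lnnX // ler_wpM2l // lnn_leS.
have : \sum_(0 <= p < B | prime p) (p * p <= m)%:R <= s%:R :> R.
  apply: (@le_trans _ _ (\sum_(0 <= p < B) (0 < p <= s)%:R)).
    rewrite big_mkcond; apply: ler_sum => p _; case: ifP => // p_pr.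
    rewrite prime_gt0 //= ler_nat; case: (leqP (p * p)%N m) => // le_pm.
    by rewrite lt0b; nia.
  by rewrite -natr_sum ler_nat (leq_trans (count B)) // geq_minr.
rewrite -mulr_suml => le_s; have : s%:R ^+ 2 <= m%:R :> R by rewrite -natrX ler_nat.
have := lnn_ge0 R m; have := ler0n R s; nra.
Qed.

Lemma nonsplit_fact_le (R : realType) B l n : odd l -> (l <= n)%N ->
  perfect_square (P 2 l n) ->
  \sum_(0 <= p < B | prime p) (~~ quad_split l p * logn p n`!)%N%:R * lnn p
    <= 14 * n%:R :> R.
Proof.
move=> l_odd le_ln Psq.
have l_gt0 : (0 < l)%N by case: l l_odd {le_ln Psq}.
have n_gt0 : (0 < n)%N by apply: leq_trans le_ln.
have form_gt0 k : (0 < 2 * k ^ 2 + l)%N by rewrite addn_gt0 l_gt0 orbT.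
have P_gt0 : (0 < P 2 l n)%N by rewrite prodn_gt0.
have dvdP p : prime p -> (p %| P 2 l n)%N -> [/\ odd p, p <= 2 * n & quad_split l p]%N.
  by move=> p_pr; apply: prime_dvd_square_P.
pose B' := (B + (2 * n).+1)%N.
apply: le_trans (ler_sum_widen R B B' _ _ _ (leq_addr _ _)) _.
  by move=> p _; rewrite mulr_ge0 ?lnn_ge0.
have lnP : lnn (P 2 l n) = \sum_(0 <= p < B' | prime p) (logn p (P 2 l n))%:R * lnn p :> R.
  by apply: lnn_decomp => // p p_pr /(dvdP _ p_pr)[_ le_p _]; rewrite /B'; lia.
have lnF : lnn n`! = \sum_(0 <= p < B' | prime p) (logn p n`!)%:R * lnn p :> R.
  by apply: lnn_decomp => [|p p_pr]; rewrite ?fact_gt0 // prime_dvd_fact // /B'; lia.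
have le_P : 2 * lnn n`! <= lnn (P 2 l n) :> R.
  rewrite -lnnX ?fact_gt0 // ler_lnn // fact_prod -mulnn -big_split /=.
  by apply: leq_prod => k _; nia.
(* A prime dividing P is split, and its excess valuation is at most two truncated logarithms, of
   numbers up to (2 n)^2 and 2 n. If p^2 > 2 n these are at most 3 and 1; otherwise they cost at
   most 3 ln (2 n) in all. *)
have bound p : prime p ->
    (logn p (P 2 l n))%:R * lnn p + 2 * ((~~ quad_split l p * logn p n`!)%N%:R * lnn p) <=
    2 * ((logn p n`!)%:R * lnn p) + 4 * ((p <= 2 * n)%:R * lnn p) +
    3 * ((p * p <= 2 * n)%:R * lnn (2 * n)) :> R.
  move=> p_pr; have p_gt1 := prime_gt1 p_pr.
  have Lp_ge0 := lnn_ge0 R p; have Ln_ge0 := lnn_ge0 R (2 * n).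
  have [p_dvd|p_ndvd] := boolP (p %| P 2 l n)%N; last first.
    rewrite [in X in X + _](_ : logn p (P 2 l n) = 0%N); last first.
      by rewrite lognE (negPf p_ndvd) !andbF.
    rewrite mul0r add0r -addrA ler_wpDr //.
      by rewrite addr_ge0 // !mulr_ge0.
    by rewrite ler_wpM2l // ler_wpM2r // ler_nat -[leqRHS]mul1n leq_mul2r leq_b1 orbT.
  have [p_odd le_p ->] := dvdP _ p_pr p_dvd.
  rewrite mul0n !mul0r mulr0 addr0 le_p mul1r.
  have := sum_logn_form_leq p l n p_pr p_odd l_gt0.
  rewrite -logn_prod_nat // -/(P 2 l n) => le_logn.
  apply: le_trans (_ : (2 * logn p n`! + trunc_log p (2 * n ^ 2 + l) +
    trunc_log p (2 * n))%N%:R * lnn p <= _); first by rewrite ler_wpM2r // ler_nat.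
  rewrite natrD natrD natrM.
  have le_form : (2 * n ^ 2 + l <= (2 * n) ^ 2)%N by nia.
  case: (leqP (p * p) (2 * n))%N => [le_pp|lt_pp].
    have t1 : (trunc_log p (2 * n))%:R * lnn p <= lnn (2 * n) :> R.
      by apply: trunc_log_lnn_le; lia.
    have t2 : (trunc_log p (2 * n ^ 2 + l))%:R * lnn p <= 2 * lnn (2 * n) :> R.
      apply: le_trans (trunc_log_lnn_le _ _ _ p_gt1 _) _; first by lia.
      by rewrite -lnnX ?ler_lnn //; lia.
    by rewrite mul1r; nra.
  have small a m : (m < p ^ a.+1)%N -> (trunc_log p m <= a)%N.
    move=> lt_m; case: (posnP m) => [->|m_gt0]; first by rewrite trunc_log0.
    rewrite -ltnS -(ltn_exp2l _ _ p_gt1); exact: leq_ltn_trans (trunc_logP p_gt1 m_gt0) lt_m.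
  have t1 : (trunc_log p (2 * n) <= 1)%N by apply: small; rewrite -mulnn.
  have t2 : (trunc_log p (2 * n ^ 2 + l) <= 3)%N.
    apply: small; apply: leq_ltn_trans le_form _.
    by rewrite (expnM p 2 2) ltn_sqr -mulnn.
  move: t1 t2; rewrite -(ler_nat R) -(ler_nat R _ 3) => t1 t2.
  rewrite mul0r mulr0 addr0; nra.
(* After summation the errors are 4 * 4 n + 3 * 4 n = 28 n, against twice the sum over nonsplit
   primes. *)
have := @ler_sum R _ (index_iota 0 B') prime _ _ bound.
rewrite !big_split /= -!mulr_sumr -lnP -lnF.
have := theta_le R B' (2 * n); have := sum_small_prime_le R B' (2 * n).
rewrite natrM; move: le_P; lra.
Qed.

(** * The contradiction *)

Local Close Scope ring_scope.

Lemma lnn_box_prod_le (R : realType) l N : 0 < l -> 0 < N ->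
  (lnn (box_prod l N) <= N%:R ^+ 2 * (2 * lnn N + lnn (l + 2)) :> R)%R.
Proof.
move=> l_gt0 N_gt0; have -> : (2 * lnn N + lnn (l + 2) = lnn ((l + 2) * N ^ 2) :> R)%R.
  by rewrite lnnM ?lnnX ?expn_gt0 ?N_gt0 ?addn_gt0 ?orbT // addrC.
rewrite -natrX -lnnX; last by rewrite muln_gt0 addn_gt0 orbT expn_gt0 N_gt0.
apply: ler_lnn; rewrite -mulnn expnM.
have -> : forall x, (x ^ N) ^ N = \prod_(1 <= b < N.+1) \prod_(1 <= a < N.+1) x.
  by move=> x; rewrite !prod_nat_const_nat subn1.
rewrite /box_prod big_nat_cond [leqRHS]big_nat_cond; apply: leq_prod => b.
rewrite andbT => /andP[_ le_b]; rewrite big_nat_cond [leqRHS]big_nat_cond.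
apply: leq_prod => a; rewrite andbT => /andP[_ le_a].
by rewrite mulnDl addnC leq_add // leq_mul2l leq_sqr -ltnS ?le_a ?le_b ?orbT.
Qed.

Local Open Scope ring_scope.

Lemma fact_quotient_le (R : realType) p N (u : R) : prime p ->
  u = (p%:R * p.-1%:R)^-1 -> (logn p (N %/ p)`!)%:R <= N%:R * u.
Proof.
move=> p_pr ->; have p_gt1 := prime_gt1 p_pr.
have PQ_gt0 : 0 < p%:R * p.-1%:R :> R by rewrite mulr_gt0 // ltr0n; lia.
rewrite ler_pdivlMr // -!natrM ler_nat.
have := logn_fact_leq p (N %/ p) p_pr; have := leq_divM N p.
move: (logn _ _) => v; move: (N %/ p)%N => q le_qN le_vq.
apply: leq_trans (_ : q * p <= _)%N => //; rewrite mulnA mulnAC leq_mul2r.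
by rewrite mulnC le_vq orbT.
Qed.

(** The valuation is at most N^2 / (p - 1) = N^2 / p + N^2 u, and N / p is less than [N %/ p] +
    1. *)
Lemma fact_square_small_le (R : realType) p N (u : R) : prime p ->
  u = (p%:R * p.-1%:R)^-1 ->
  (logn p (N ^ 2)`!)%:R <= N%:R * (logn p N`!)%:R + N%:R + N%:R ^+ 2 * u.
Proof.
move=> p_pr ->; have p_gt1 := prime_gt1 p_pr.
have PQ_gt0 : 0 < p%:R * p.-1%:R :> R by rewrite mulr_gt0 // ltr0n; lia.
rewrite -lerBlDl ler_pdivlMr // mulrBl lerBlDr -natrX -!natrM -natrD -!natrM -natrD ler_nat.
have := logn_fact_leq p (N ^ 2) p_pr; have := ltn_ceil N (prime_gt0 p_pr).
rewrite (logn_factE _ N) //.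
move: (logn _ _) (logn _ _) => w v; move: (N %/ p)%N => q lt_N le_v.
rewrite -!mulnn in le_v *; case: p p_gt1 {p_pr PQ_gt0} lt_N le_v => // p _ /= lt_N le_v.
have h1 : (v * (p.+1 * p) <= p.+1 * (N * N))%N by rewrite mulnCA leq_mul2l mulnC le_v orbT.
have h2 : (p * N * N <= p * N * (q.+1 * p.+1))%N by rewrite leq_mul2l ltnW ?orbT.
nia.
Qed.

(** The left side of the summed valuation bound is about 7 N^2 ln N + 2 N^2 ln N, while 4 ln F gives
    only 8 N^2 ln N; the surplus N^2 ln N must be O(N^2). The constant 48 is 7 + 1 from the two
    factorials, 2 + 2 from Chebyshev and 9 * 4 from the convergent series. *)
Lemma lnn_le_of_nonsplit (R : realType) l N (C : R) : odd l -> (l <= N)%N ->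
  \sum_(0 <= p < (N ^ 2).+1 | prime p)
    (~~ quad_split l p * logn p (N ^ 2)`!)%N%:R * lnn p <= C * N%:R ^+ 2 ->
  lnn N <= 48 + 9 * C + 12 * lnn (l + 2).
Proof.
move=> l_odd le_lN; set B := (N ^ 2).+1 => nonsplit_le.
have l_gt0 : (0 < l)%N by case: l l_odd {le_lN nonsplit_le}.
have N_gt0 : (0 < N)%N by apply: leq_trans le_lN.
(* Of the 8 copies of N times the valuation of [N]![, one pays for that of](N ^ 2)[!] at primes p <=
   N. Each 9 is 8 + 1: rows plus factorial. *)
have bound p : prime p -> 7 * N%:R * ((logn p N`!)%:R * lnn p) +
    (logn p (N ^ 2)`!)%:R * lnn p <=
    4 * ((logn p (box_prod l N))%:R * lnn p) +
    9 * ((~~ quad_split l p * logn p (N ^ 2)`!)%N%:R * lnn p) +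
    8 * N%:R ^+ 2 * ((logn p l)%:R * lnn p) +
    N%:R * ((p <= N)%:R * lnn p) + (p <= N ^ 2)%:R * lnn p +
    9 * N%:R ^+ 2 * (lnn p / (p%:R * p.-1%:R)) :> R.
  move=> p_pr; set u := (p%:R * p.-1%:R)^-1; have Lp_ge0 := lnn_ge0 R p.
  have bound1 := fact_quotient_le R p N u p_pr erefl.
  have bound2 := fact_square_small_le R p N u p_pr erefl.
  have u_ge0 : 0 <= u by rewrite invr_ge0 mulr_ge0.
  have n_ge0 : 0 <= N%:R :> R by [].
  have logn_N : (logn p N`!)%:R = (N %/ p)%:R + (logn p (N %/ p)`!)%:R :> R.
    by rewrite -natrD -logn_factE.
  have dvd_l : (p %| l)%:R * (N %/ p)%:R <= N%:R * (logn p l)%:R :> R.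
    rewrite -!natrM ler_nat; case: (boolP (p %| l)%N) => // p_dvd.
    have : (0 < logn p l)%N by rewrite logn_gt0 mem_primes p_pr l_gt0.
    by have := leq_div N p; nia.
  have nonsplit : (~~ quad_split l p)%:R * (8 * N%:R * (N %/ p)%:R + (logn p (N ^ 2)`!)%:R) <=
      9 * (~~ quad_split l p * logn p (N ^ 2)`!)%N%:R :> R.
    have : (N * (N %/ p) <= logn p (N ^ 2)`!)%N.
      apply: leq_trans (_ : N * logn p N`! <= _)%N.
        by rewrite leq_mul2l logn_factE // leq_addr orbT.
      by rewrite -mulnn; apply: logn_factM_ge.
    rewrite natrM -(ler_nat R) natrM => le_q.
    by case: (quad_split l p); rewrite ?mul0r ?mulr0 // !mul1r; lra.
  have small : (p <= N)%:R * (logn p (N ^ 2)`!)%:R <=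
      N%:R * (logn p N`!)%:R + N%:R * (p <= N)%:R + N%:R ^+ 2 * u.
    case: leqP => _; rewrite ?mul1r ?mulr1 // mul0r mulr0 addr0.
    by rewrite addr_ge0 ?mulr_ge0 ?exprn_ge0.
  have := box_prod_valuation p l N p_pr l_odd le_lN.
  rewrite -(ler_nat R) !natrD !natrM natrD !natrM => val.
  have n1 := ler_wpM2l n_ge0 bound1; have n2 := ler_wpM2l n_ge0 dvd_l.
  have coef : 7 * N%:R * (logn p N`!)%:R + (logn p (N ^ 2)`!)%:R <=
    4 * (logn p (box_prod l N))%:R + 9 * (~~ quad_split l p * logn p (N ^ 2)`!)%N%:R +
    8 * N%:R ^+ 2 * (logn p l)%:R + N%:R * (p <= N)%:R + (p <= N ^ 2)%:R +
    9 * N%:R ^+ 2 * u by rewrite logn_N in small *; lra.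
  by have := ler_wpM2r Lp_ge0 coef; lra.
have := @ler_sum R _ (index_iota 0 B) prime _ _ bound.
rewrite !big_split /= -!mulr_sumr.
have le_B n : (n <= N ^ 2)%N -> lnn n`! = \sum_(0 <= p < B | prime p) (logn p n`!)%:R * lnn p :> R.
  move=> le_n; apply: lnn_decomp => [|p p_pr]; rewrite ?fact_gt0 // prime_dvd_fact // ltnS.
  by move/leq_trans; apply.
rewrite -!le_B //; last by rewrite -mulnn leq_pmulr.
have := theta_le R B N; have := theta_le R B (N ^ 2).
have := sum_lnn_div_le R B.
have := lnn_ge_sum R l B l_gt0.
have := lnn_ge_sum R _ B (box_prod_gt0 l N l_gt0).
have := lnn_box_prod_le R l N l_gt0 N_gt0.
have := lnn_fact_ge R N; have := lnn_fact_ge R (N ^ 2).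
have : lnn l <= lnn (l + 2) :> R by rewrite ler_lnn // leq_addr.
move: nonsplit_le.
rewrite lnnX // natrX.
move: (lnn N) (lnn l) (lnn (l + 2)) (lnn (box_prod l N)) (lnn N`!) (lnn (N ^ 2)`!).
move: (\sum_(_ <= _ < _ | _) _) (\sum_(_ <= _ < _ | _) _) (\sum_(_ <= _ < _ | _) _)
  (\sum_(_ <= _ < _ | _) _) (\sum_(_ <= _ < _ | _) _) (\sum_(_ <= _ < _ | _) _).
have n_ge1 : 1 <= N%:R :> R by rewrite ler1n.
move: (N%:R : R) n_ge1 => n n_ge1 s1 s2 s3 s4 s5 s6 a b c d e f.
move=> h6 hbc hf he hd h5 h4 h3 h2 h1 main.
have n_ge0 : 0 <= n by lra.
have n2_gt0 : 0 < n ^+ 2 by rewrite exprn_gt0 //; lra.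
rewrite -(ler_pM2l n2_gt0).
have := ler_wpM2l n_ge0 he; have := ler_wpM2l n_ge0 h1.
have := ler_wpM2l (ltW n2_gt0) (le_trans h4 hbc); have := ler_wpM2l (ltW n2_gt0) h3.
lra.
Qed.

Local Close Scope ring_scope.

Theorem theorem1 (l : nat) (l_gt0 : 0 < l) (l_odd : odd l) :
  exists N : nat, 0 < N /\
    forall n : nat, N <= n -> ~ perfect_square (P 2 l n).
Proof.
pose R : realType := Rdefinitions.R.
(* Here C = 42 = 14 * 3: the nonsplit sum for n is at most 14 n, and n <= s^2 + 2 s <= 3 s^2 for the
   integer square root s. *)
pose K : R := (48 + 9 * 42 + 12 * lnn (l + 2))%R.
pose N0 := maxn l (Num.bound (expR K)).
have le_lN0 : l <= N0 by rewrite leq_maxl.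
have N0_gt0 : 0 < N0 by apply: leq_trans le_lN0.
have ltK : (K < lnn N0)%R.
  rewrite -[X in (X < _)%R]expRK ltr_ln ?posrE ?expR_gt0 ?ltr0n //.
  apply: lt_le_trans (archi_boundP (expR_ge0 K)) _.
  by rewrite ler_nat leq_maxr.
exists (N0 ^ 2); split=> [|n le_n Psq]; first by rewrite expn_gt0 N0_gt0.
have [s /andP[le_s lt_s]] := exists_sqrt n.
have le_N0s : N0 <= s by rewrite -ltnS -ltn_sqr (leq_ltn_trans le_n).
have le_ln : l <= n.
  by apply: leq_trans le_n; rewrite (leq_trans le_lN0) // -mulnn leq_pmulr.
have le_n3 : n <= 3 * s ^ 2 by nia.
suff /(le_trans (ler_lnn R _ _ le_N0s)) : (lnn s <= K)%R by rewrite leNgt ltK.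
apply: lnn_le_of_nonsplit => //; first exact: leq_trans le_lN0 le_N0s.
apply: le_trans (_ : 14 * n%:R <= _)%R; last first.
  rewrite (_ : 42 = 14 * 3)%R; last by ring.
  by rewrite -mulrA ler_wpM2l // -natrX -natrM ler_nat.
apply: le_trans (nonsplit_fact_le R (s ^ 2).+1 l n l_odd le_ln Psq).
(* Passing from n down to s^2 only decreases the factorial valuations. *)
apply: ler_sum => p _; rewrite ler_wpM2r ?lnn_ge0 // ler_nat leq_mul2l.
by rewrite -(subnK le_s) (leq_trans _ (logn_factD_ge _ _ _)) ?orbT // leq_addl.
Qed.
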